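(* Let $\nu\ge 0$ and let $\{(\hat y_k,\hat u_k)\}_{1\le k\le K}$ be the data. Assume that $w=(w_1,\dots,w_L)\in\mathcal W$, with associated $u_1,\dots,u_K\in\mathcal U$, is a solution of the relaxed outer-problem $$\min\ \frac1{2K}\sum_{k=1}^K\|u_k-\hat u_k\|_{\mathcal U}^2+\frac{\nu}{2}\|w\|_{\mathcal W}^2\quad\text{subject to } G(u_k,w,\hat y_k)=0\ \text{ for all }1\le k\le K,$$ i.e. $(u_1,\dots,u_K,w)\in\mathcal U^K\times\mathcal W$ satisfies the constraints and minimizes the objective among all elements of $\mathcal U^K\times\mathcal W$ satisfying them. Then $G(u_k,w,\hat y_k)=0$ for all $1\le k\le K$, and necessarily, for all $1\le\ell\le L$, $$\mathbf G_\ell(w):=\nu w_\ell+\frac1K\sum_{k=1}^K G'_{w_\ell}(u_k,w,\hat y_k)^*\mu_k=0,$$ where, for each $1\le k\le K$, $\mu_k\in\mathcal U$ is the solution of $$G'_u(u_k,w,\hat y_k)^*\mu_k+(u_k-\hat u_k)=0 .$$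
   Context: Spaces. $\mathcal Y,\mathcal Q$ are real Banach spaces, $\mathcal Q$ reflexive; $\mathcal U\simeq\mathbb R^{n_{\rm in}}$ is a finite-dimensional Hilbert space (identified with its dual $\mathcal U'$ where needed); $\mathcal V\simeq\mathbb R^{n_{\rm out}}$; $\varphi:\mathcal Y\times\mathcal U\to\mathcal Q'$; $\gamma:\mathcal V\to\mathbb R$ is smooth. The data are $\hat u_k\in\mathcal U$ and $\hat y_k$ in a finite-dimensional subspace of $\mathcal Y$, $1\le k\le K$. Neural networks. Fix $L\ge1$ and dimensions $n_1=n_{\rm in},n_2,\dots,n_L,n_{L+1}=n_{\rm out}$. $\mathcal W=\prod_{\ell=1}^L\mathrm{Aff}(\mathbb R^{n_\ell},\mathbb R^{n_{\ell+1}})$ is the space of tuples $w=(w_1,\dots,w_L)$ of affine maps $w_\ell(z)=A_\ell z+b_\ell$, $A_\ell\in\mathbb R^{n_{\ell+1}\times n_\ell}$, $b_\ell\in\mathbb R^{n_{\ell+1}}$, with Euclidean norm $\|w\|_{\mathcal W}^2=\sum_\ell(\mathrm{trace}(A_\ell^TA_\ell)+|b_\ell|^2)$. For $\rho:\mathbb R\to\mathbb R$ applied coordinatewise, $r(w,u)=w_L(\rho(w_{L-1}(\rho(\cdots\rho(w_1(u))\cdots))))\in\mathcal V$ (for $L=1$, $r(w,u)=w_1(u)$). Standing assumptions. (A1) $\varphi$ is $C^2$, and for every $u\in\mathcal U$ there is $y\in\mathcal Y$ with $\varphi(y,u)=0$. (A2) For all $(\bar y,\bar u)$, $\varphi'_y(\bar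 y,\bar u):\mathcal Y\to\mathcal Q'$ is surjective and there is $C(\bar y,\bar u)>0$ with $\|y\|_{\mathcal Y}\le C(\bar y,\bar u)\|\varphi'_y(\bar y,\bar u).y\|_{\mathcal Q'}$ for all $y\in\mathcal Y$. (A3) For the $\hat y$ considered, the problem of minimizing $c(y,\hat y)$ over $(y,u)\in\mathcal Y\times\mathcal U$ subject to $\varphi(y,u)=0$ has a global minimizer. (A4) For all $\hat y$, $c(\cdot,\hat y):\mathcal Y\to\mathbb R$ is twice continuously Fréchet differentiable. (A5) $\rho$ is $C^2$. Parameter-to-state map. $\mathbb S:\mathcal U\to\mathcal Y$ denotes the $C^2$ map with $\varphi(y,u)=0\Leftrightarrow y=\mathbb S(u)$ for all $(y,u)\in\mathcal Y\times\mathcal U$. Gradient of the inner-problem. For $u\in\mathcal U$, $w\in\mathcal W$, $G(u,w,\hat y)\in\mathcal U'$ is the derivative with respect to $u$ of $u\mapsto c(\mathbb S(u),\hat y)+\gamma(r(w,u))$, that is $$G(u,w,\hat y)=\mathbb S'(u)^*c'_y(\mathbb S(u),\hat y)+r'_u(w,u)^*\gamma'(r(w,u)).$$ $G'_u$ and $G'_{w_\ell}$ denote its partial derivatives with respect to $u$ and to the $\ell$-th component $w_\ell$ of $w$; $G'_u(u,w,\hat y)\in\mathcal L(\mathcal U,\mathcal U')$, $G'_{w_\ell}(u,w,\hat y)\in\mathcal L(\mathrm{Aff}(\mathbb R^{n_\ell},\mathbb R^{n_{\ell+1}}),\mathcal U')$, and ${}^*$ denotes the adjoint, the finite-dimensional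 spaces being identified with their duals through their Euclidean inner products.
   Formalization: The existence and uniqueness of the solution μ_k of the adjoint equation, for each k, are assumed rather than asserted; they can fail under (A1)–(A5), e.g. φ(y,u)=y−u, c=y⁴/4, γ=0, û=1, where the equation reads 0·μ−1=0. *)

(* Defs.v *)
From HB Require Import structures.
From mathcomp Require Import all_boot all_order all_algebra.
From mathcomp Require Import all_classical all_reals all_analysis.

Set Implicit Arguments.
Unset Strict Implicit.
Unset Printing Implicit Defensive.

Import Order.TTheory GRing.Theory Num.Theory.
Import numFieldNormedType.Exports.

Local Open Scope classical_set_scope.
Local Open Scope ring_scope.

(** * Bounded linear operators, with the operator norm *)

Section BoundedOperators.
Context {R : realType} {V W : normedModType R}.

Definition bounded_op_pred : {pred (V -> W)} :=
  [pred f : V -> W | `[< linear f /\ continuous f >]].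

Lemma bounded_op_predP (f : V -> W) :
  reflect (linear f /\ continuous f) (f \in bounded_op_pred).
Proof. exact: asboolP. Qed.

Record bounded_op := BoundedOp {
  bounded_op_fun :> V -> W;
  _ : bounded_op_fun \in bounded_op_pred }.

HB.instance Definition _ := [isSub for bounded_op_fun].
HB.instance Definition _ := [Choice of bounded_op by <:].

Lemma bounded_op_submod_closed : submod_closed bounded_op_pred.
Proof.
split=> [|a f g].
  apply/bounded_op_predP; split; last exact: cst_continuous.
  by move=> a x y /=; rewrite scaler0 addr0.
move=> /bounded_op_predP[lf cf] /bounded_op_predP[lg cg].
apply/bounded_op_predP; split.
  move=> b x y; rewrite /= !fctE lf lg !scalerDr !scalerA.
  by rewrite [a * b]mulrC addrACA.
move=> x; apply: cvgD; last exact: cg.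
by apply: cvgZr; exact: cf.
Qed.

HB.instance Definition _ :=
  GRing.isSubmodClosed.Build R (V -> W) bounded_op_pred bounded_op_submod_closed.
HB.instance Definition _ := [SubChoice_isSubLmodule of bounded_op by <:].

Lemma bounded_op_linear (f : bounded_op) : linear f.
Proof. by have /bounded_op_predP[] := valP f. Qed.

Lemma bounded_op_continuous (f : bounded_op) : continuous f.
Proof. by have /bounded_op_predP[] := valP f. Qed.

HB.instance Definition _ (f : bounded_op) :=
  GRing.isLinear.Build R V W *:%R (f : V -> W) (bounded_op_linear f).

Definition opnorm (f : bounded_op) : R :=
  sup [set `|f x| | x in [set x : V | `|x| <= 1]].

Lemma opnorm_has_sup (f : bounded_op) :
  has_sup [set `|f x| | x in [set x : V | `|x| <= 1]].
Proof.
split; first by exists `|f 0|, 0 => //=; rewrite normr0.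
have /continuous_linear_bounded : {for 0, continuous (f : {linear V -> W})}.
  exact: bounded_op_continuous.
move=> /(_ 0)/bounded_funP/(_ 1)[M fM].
by exists M => _ [x /= x1 <-]; exact: fM.
Qed.

Lemma opnormP (f : bounded_op) x : `|f x| <= opnorm f * `|x|.
Proof.
have [->|x0] := eqVneq x 0; first by rewrite linear0 !normr0 mulr0.
have nx : 0 < `|x| by rewrite normr_gt0.
rewrite -ler_pdivrMr//.
have -> : `|f x| / `|x| = `|f (`|x|^-1 *: x)|.
  by rewrite linearZ/= normrZ ger0_norm ?invr_ge0 ?ltW// mulrC.
apply: (ub_le_sup (opnorm_has_sup f).2).
exists (`|x|^-1 *: x) => //=.
by rewrite normrZ ger0_norm ?invr_ge0 ?(ltW nx)// mulVf ?lexx ?gt_eqF.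
Qed.

Lemma opnorm_ge0 (f : bounded_op) : 0 <= opnorm f.
Proof.
apply: (le_trans (normr_ge0 (f 0))).
by apply: (ub_le_sup (opnorm_has_sup f).2); exists 0 => //=; rewrite normr0.
Qed.

Lemma opnorm_le (f : bounded_op) M : 0 <= M ->
  (forall x, `|f x| <= M * `|x|) -> opnorm f <= M.
Proof.
move=> M0 fM; apply: ge_sup; first exact: (opnorm_has_sup f).1.
by move=> _ [x /= x1 <-]; rewrite (le_trans (fM x))// ler_piMr.
Qed.

Lemma bounded_opDE (f g : bounded_op) x : (f + g) x = f x + g x.
Proof. by []. Qed.

Lemma bounded_opZE a (f : bounded_op) x : (a *: f) x = a *: f x.
Proof. by []. Qed.

Lemma opnormD (f g : bounded_op) : opnorm (f + g) <= opnorm f + opnorm g.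
Proof.
apply: opnorm_le => [|x]; first by rewrite addr_ge0 ?opnorm_ge0.
rewrite bounded_opDE (le_trans (ler_normD _ _))// mulrDl.
by rewrite lerD ?opnormP.
Qed.

Lemma opnormZ_le a (f : bounded_op) : opnorm (a *: f) <= `|a| * opnorm f.
Proof.
apply: opnorm_le => [|x]; first by rewrite mulr_ge0 ?opnorm_ge0.
by rewrite bounded_opZE normrZ -mulrA ler_wpM2l ?opnormP.
Qed.

Lemma opnormZ a (f : bounded_op) : opnorm (a *: f) = `|a| * opnorm f.
Proof.
apply/eqP; rewrite eq_le opnormZ_le/=.
have [->|a0] := eqVneq a 0; first by rewrite normr0 mul0r opnorm_ge0.
rewrite -ler_pdivlMl ?normr_gt0// -normfV.
by rewrite -[in leLHS](scale1r f) -(mulVf a0) -scalerA opnormZ_le.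
Qed.

Lemma opnorm0_eq0 (f : bounded_op) : opnorm f = 0 -> f = 0.
Proof.
move=> f0; apply/val_inj/funext => x /=.
by apply/eqP; rewrite -normr_le0 (le_trans (opnormP f x))// f0 mul0r.
Qed.

HB.instance Definition _ :=
  Lmodule_isNormed.Build R bounded_op opnormD opnormZ opnorm0_eq0.

(** The Fréchet derivative [ 'd f x ] as a bounded operator; the value is
    meaningful only where [f] is differentiable, see [fderivE]. *)
Definition fderiv (f : V -> W) (x : V) : bounded_op := insubd 0 ('d f x : V -> W).

Lemma fderivE (f : V -> W) (x : V) : differentiable f x ->
  fderiv f x = 'd f x :> (V -> W).
Proof.
move=> df; rewrite /fderiv insubdK//; apply/bounded_op_predP; split.
  exact: linearP.
exact: diff_continuous.
Qed.

End BoundedOperators.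
Arguments bounded_op {R} V W.

Notation dual R V := (@bounded_op R V R^o).

Definition reflexive_space {R : realType} (Q : normedModType R) : Prop :=
  forall xi : dual R (dual R Q), exists q : Q, forall f : dual R Q, xi f = f q.

(** [Ck k f]: [f] is [k] times continuously Fréchet differentiable on the whole
    space, the derivatives being continuous for the operator norm. *)
Fixpoint Ck {R : realType} {V : normedModType R} (k : nat)
    : forall W : normedModType R, (V -> W) -> Prop :=
  if k is j.+1 then fun W f =>
    (forall x, differentiable f x) /\ Ck j (fderiv f)
  else fun W f => continuous f.

Definition finite_dim_subspace {R : realType} {Y : normedModType R} (A : set Y)
    : Prop :=
  exists (d : nat) (e : 'I_d -> Y),
    A = [set y | exists a : 'I_d -> R, y = \sum_(i < d) a i *: e i].

(** * Euclidean structure and adjoints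

    The topology that the library puts on matrices and on products comes from
    sup norms, which are equivalent to the Euclidean ones; the Euclidean norms
    and inner products are the ones below.  For column vectors
    [mxdot u v] is the usual scalar product of R^n. *)

Notation Aff R m n := ('M[R]_(n, m) * 'cV[R]_n)%type.

Section Euclidean.
Context {R : realType}.

Definition mxdot {m n} (A B : 'M[R]_(m, n)) : R := \tr (A^T *m B).

Definition affdot {m n} (a b : Aff R m n) : R :=
  mxdot a.1 b.1 + mxdot a.2 b.2.

(** Riesz representatives of linear forms. *)
Definition mx_riesz {m n} (f : 'M[R]_(m, n) -> R) : 'M[R]_(m, n) :=
  \matrix_(i, j) f (delta_mx i j).

Definition aff_riesz {m n} (f : Aff R m n -> R) : Aff R m n :=
  (mx_riesz (fun A => f (A, 0)), mx_riesz (fun b => f (0, b))).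

(** Adjoints of operators with values in the dual of a space U, characterized
    by [<T^* mu, h> = (T h) mu], see [mx_adjP] and [aff_adjP]. *)
Definition mx_adj {m n} {U : normedModType R}
    (T : bounded_op 'M[R]_(m, n) (dual R U)) (mu : U) : 'M[R]_(m, n) :=
  mx_riesz (fun h => T h mu).

Definition aff_adj {m n} {U : normedModType R}
    (T : bounded_op (Aff R m n) (dual R U)) (mu : U) : Aff R m n :=
  aff_riesz (fun a => T a mu).

Lemma mxdotE m n (A B : 'M[R]_(m, n)) :
  mxdot A B = \sum_i \sum_j A i j * B i j.
Proof.
rewrite /mxdot /mxtrace exchange_big; apply: eq_bigr => j _ /=.
by rewrite mxE; apply: eq_bigr => i _; rewrite mxE.
Qed.

Lemma mx_rieszP m n (f : {linear 'M[R]_(m, n) -> R^o}) h :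
  mxdot (mx_riesz f) h = f h.
Proof.
rewrite mxdotE [in RHS](matrix_sum_delta h) linear_sum; apply: eq_bigr => i _.
rewrite linear_sum; apply: eq_bigr => j _.
by rewrite linearZ mxE mulrC.
Qed.

Lemma bounded_op_evalL (V U : normedModType R) (T : bounded_op V (dual R U)) mu :
  linear (fun h => T h mu : R^o).
Proof. by move=> a x y; rewrite linearP bounded_opDE bounded_opZE. Qed.

Lemma mx_adjP m n (U : normedModType R)
    (T : bounded_op 'M[R]_(m, n) (dual R U)) (mu : U) h :
  mxdot (mx_adj T mu) h = T h mu.
Proof.
pose F := GRing.isLinear.Build _ _ _ _ _ (bounded_op_evalL T mu).
pose f : {linear 'M[R]_(m, n) -> R^o} := HB.pack (fun h => T h mu : R^o) F.
exact: (mx_rieszP f).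
Qed.

Lemma aff_adjP m n (U : normedModType R)
    (T : bounded_op (Aff R m n) (dual R U)) (mu : U) h :
  affdot (aff_adj T mu) h = T h mu.
Proof.
have L := bounded_op_evalL T mu.
have L1 : linear (fun A : 'M[R]_(n, m) => T (A, 0) mu : R^o).
  move=> a x y; rewrite -L; congr (T _ mu).
  by apply/pair_equal_spec; split=> //=; rewrite scaler0 addr0.
have L2 : linear (fun b : 'cV[R]_n => T (0, b) mu : R^o).
  move=> a x y; rewrite -L; congr (T _ mu).
  by apply/pair_equal_spec; split=> //=; rewrite scaler0 addr0.
pose f1 : {linear 'M[R]_(n, m) -> R^o} :=
  HB.pack (fun A : 'M[R]_(n, m) => T (A, 0) mu : R^o)
    (GRing.isLinear.Build _ _ _ _ _ L1).
pose f2 : {linear 'cV[R]_n -> R^o} :=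
  HB.pack (fun b : 'cV[R]_n => T (0, b) mu : R^o)
    (GRing.isLinear.Build _ _ _ _ _ L2).
rewrite /affdot (mx_rieszP f1) (mx_rieszP f2) /= -bounded_opDE -linearD.
by case: h => A b; congr (T _ mu); apply/pair_equal_spec; split;
  rewrite /= ?addr0 ?add0r.
Qed.

End Euclidean.

(** * Feedforward networks

    Layers are numbered from 0: [w l] is an affine map from R^(n l) to
    R^(n l.+1), so that the network goes from R^(n 0) to R^(n L). *)

Section Network.
Context {R : realType} (L : nat) (n : nat -> nat).

Definition weights := forall l : 'I_L, Aff R (n l) (n l.+1).

Definition weights_sqnorm (w : weights) : R := \sum_(l < L) affdot (w l) (w l).

Definition aff_app {p q} (a : Aff R p q) (z : 'cV[R]_p) : 'cV[R]_q :=
  a.1 *m z + a.2.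

(** The activation is applied to the input of every affine map but the first. *)
Fixpoint layer (rho : R -> R) (w : weights) (u : 'cV[R]_(n 0%N)) (k : nat)
    : (k <= L)%N -> 'cV[R]_(n k) :=
  if k is j.+1 then fun jL : (j < L)%N =>
    let z := layer rho w u (ltnW jL) in
    aff_app (w (Ordinal jL)) (if j == 0%N then z else map_mx rho z)
  else fun _ => u.

Definition network (rho : R -> R) (w : weights) (u : 'cV[R]_(n 0%N))
    : 'cV[R]_(n L) :=
  layer rho w u (leqnn L).

End Network.
Arguments weights R L n : clear implicits.

(** * The inner gradient and the relaxed outer problem *)

Section OuterProblem.
Context {R : realType} {Y : normedModType R} {L : nat} {n : nat -> nat}.
Variables (c : Y -> Y -> R) (gamma : 'cV[R]_(n L) -> R) (rho : R -> R).
Variable Smap : 'cV[R]_(n 0%N) -> Y.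

Definition inner_objective (w : weights R L n) (yhat : Y) (u : 'cV[R]_(n 0%N))
    : R^o :=
  c (Smap u) yhat + gamma (network rho w u).

Definition inner_grad (u : 'cV[R]_(n 0%N)) (w : weights R L n) (yhat : Y)
    : dual R 'cV[R]_(n 0%N) :=
  fderiv (inner_objective w yhat) u.

Definition inner_grad_u (u : 'cV[R]_(n 0%N)) (w : weights R L n) (yhat : Y)
    : bounded_op 'cV[R]_(n 0%N) (dual R 'cV[R]_(n 0%N)) :=
  fderiv (fun v => inner_grad v w yhat) u.

Definition inner_grad_w (l : 'I_L) (u : 'cV[R]_(n 0%N)) (w : weights R L n)
    (yhat : Y) : bounded_op (Aff R (n l) (n l.+1)) (dual R 'cV[R]_(n 0%N)) :=
  fderiv (fun a : Aff R (n l) (n l.+1) => inner_grad u (dfwith w l a) yhat) (w l).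

Context {K : nat}.
Variables (yhat : 'I_K -> Y) (uhat : 'I_K -> 'cV[R]_(n 0%N)) (nu : R).

Definition outer_objective (u : 'I_K -> 'cV[R]_(n 0%N)) (w : weights R L n) : R :=
  (2 * K%:R)^-1 * \sum_(k < K) mxdot (u k - uhat k) (u k - uhat k)
  + nu / 2 * weights_sqnorm w.

Definition outer_feasible (u : 'I_K -> 'cV[R]_(n 0%N)) (w : weights R L n) : Prop :=
  forall k, inner_grad (u k) w (yhat k) = 0.

Definition outer_solution (u : 'I_K -> 'cV[R]_(n 0%N)) (w : weights R L n) : Prop :=
  outer_feasible u w /\
  forall u' w', outer_feasible u' w' ->
    outer_objective u w <= outer_objective u' w'.

Definition adjoint_equation (u : 'I_K -> 'cV[R]_(n 0%N)) (w : weights R L n)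
    (k : 'I_K) (mu : 'cV[R]_(n 0%N)) : Prop :=
  mx_adj (inner_grad_u (u k) w (yhat k)) mu + (u k - uhat k) = 0.

Definition outer_grad (u : 'I_K -> 'cV[R]_(n 0%N)) (w : weights R L n)
    (mu : 'I_K -> 'cV[R]_(n 0%N)) (l : 'I_L) : Aff R (n l) (n l.+1) :=
  nu *: w l
  + K%:R^-1 *: \sum_(k < K) aff_adj (inner_grad_w l (u k) w (yhat k)) (mu k).

End OuterProblem.

(* Main.v *)
Require Import Defs.
From HB Require Import structures.
From mathcomp Require Import all_boot all_order all_algebra.
From mathcomp Require Import all_classical all_reals all_analysis.
From mathcomp Require Import ring lra.

(** Freeze every layer of [w] but the [l]-th.  Uniqueness of the adjoint states
    makes each [G'_u(u_k, w)] invertible, so the implicit function theorem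
    solves [G(u, w) = 0] near [u_k] as [u = g_k(w_l)] with
    [G'_u g_k' = - G'_{w_l}].  The outer objective along
    [(g_1(a), ..., g_K(a), a)] has a local minimum at [a = w_l], so its
    derivative vanishes there; eliminating [g_k'] with the adjoint equation
    turns this into [outer_grad = 0].

    The implicit function comes from the contraction [u |-> u - N G(u, a)],
    with [N] inverse to [G'_u(u_k, w)]; it is only needed to be differentiable
    at the base point. *)

Set Implicit Arguments.
Unset Strict Implicit.
Unset Printing Implicit Defensive.

Import Order.TTheory GRing.Theory Num.Theory.
Import numFieldNormedType.Exports.

Local Open Scope classical_set_scope.
Local Open Scope ring_scope.

(** * Bounded operators and Fréchet derivatives *)

Section FrechetCalculus.
Context {R : realType}.
Implicit Types U V W X : normedModType R.

Lemma linear_bound_continuous V W (f : V -> W) (M : R) :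
  linear f -> (forall x, `|f x| <= M * `|x|) -> continuous f.
Proof.
move=> lf fM.
pose F : {linear V -> W} := HB.pack f (GRing.isLinear.Build _ _ _ _ _ lf).
apply/(linear_bounded_continuous F)/bounded_funP => r.
exists (`|M| * r) => x xr; apply: (le_trans (fM x)).
apply: le_trans (_ : `|M| * `|x| <= _); last exact: ler_wpM2l.
by rewrite ler_wpM2r// ler_norm.
Qed.

(** The explicit bound does double duty: it gives continuity, and through [mkbop_norm] an operator
    norm estimate. The operators built from it end with [Defined], so that their values at a point
    reduce by conversion. *)
Definition mkbop V W (f : V -> W) (lf : linear f) (M : R)
    (fM : forall x, `|f x| <= M * `|x|) : bounded_op V W :=
  BoundedOp
    (introT (bounded_op_predP f) (conj lf (linear_bound_continuous lf fM))).

Lemma mkbop_norm V W (f : V -> W) (lf : linear f) (M : R) fM :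
  0 <= M -> `|@mkbop V W f lf M fM| <= M.
Proof. by move=> M0; apply: opnorm_le. Qed.

Lemma bop_norm V W (f : bounded_op V W) x : `|f x| <= `|f| * `|x|.
Proof. exact: opnormP. Qed.

Lemma bopP V W (f g : bounded_op V W) : (forall x, f x = g x) -> f = g.
Proof. by move=> fg; apply/val_inj/funext. Qed.

Definition bcomp V W X (g : bounded_op W X) (f : bounded_op V W) :
  bounded_op V X.
Proof.
refine (@mkbop _ _ (fun x => g (f x)) _ (`|g| * `|f|) _).
- by move=> a x y; rewrite !linearP.
- move=> x; rewrite -mulrA (le_trans (bop_norm _ _))//.
  by rewrite ler_wpM2l// bop_norm.
Defined.

Lemma bcompE V W X (g : bounded_op W X) (f : bounded_op V W) x :
  bcomp g f x = g (f x).
Proof. by []. Qed.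

Lemma bcomp_norm V W X (g : bounded_op W X) (f : bounded_op V W) :
  `|bcomp g f| <= `|g| * `|f|.
Proof. by rewrite mkbop_norm// mulr_ge0. Qed.

Definition bcompl V W X (g : bounded_op W X) :
  bounded_op (bounded_op V W) (bounded_op V X).
Proof.
refine (@mkbop _ _ (fun f => bcomp g f) _ `|g| _).
- move=> a x y; apply: bopP => z.
  by rewrite bcompE !bounded_opDE !bounded_opZE linearP.
- by move=> f; exact: bcomp_norm.
Defined.

(** Composition as a curried bounded bilinear map, so that the chain and product rules become
    instances of the calculus of bilinear maps. *)
Definition bcompB V W X :
  bounded_op (bounded_op W X) (bounded_op (bounded_op V W) (bounded_op V X)).
Proof.
refine (@mkbop _ _ (fun g => bcompl V g) _ 1 _).
- by move=> a x y; do 2 apply: bopP => ?.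
- by move=> g; rewrite mul1r mkbop_norm.
Defined.

Lemma bilin_linearl V W X (B : bounded_op V (bounded_op W X)) w :
  linear (fun v => B v w).
Proof. by move=> a x y; rewrite linearP. Qed.

Lemma bilin_norm V W X (B : bounded_op V (bounded_op W X)) w v :
  `|B v w| <= (`|B| * `|w|) * `|v|.
Proof.
rewrite mulrAC (le_trans (bop_norm _ _))//.
by rewrite ler_wpM2r// bop_norm.
Qed.

Definition bflip V W X (B : bounded_op V (bounded_op W X)) :
  bounded_op W (bounded_op V X).
Proof.
refine (@mkbop _ _
  (fun w => mkbop (bilin_linearl B w) (bilin_norm B w)) _ `|B| _).
- by move=> a x y; apply: bopP => v; rewrite /= linearP.
- by move=> w; rewrite mkbop_norm// mulr_ge0.
Defined.

Lemma bflipE V W X (B : bounded_op V (bounded_op W X)) v w :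
  bflip B w v = B v w.
Proof. by []. Qed.

Lemma linear_pair1 V W : linear (fun v : V => (v, 0 : W)).
Proof. by move=> a x y; apply/pair_equal_spec; rewrite /= scaler0 addr0. Qed.

Lemma linear_pair2 V W : linear (fun w : W => (0 : V, w)).
Proof. by move=> a x y; apply/pair_equal_spec; rewrite /= scaler0 addr0. Qed.

Definition binl V W : bounded_op V (V * W)%type.
Proof.
refine (@mkbop _ _ (fun v => (v, 0)) (@linear_pair1 V W) 1 _).
by move=> x; rewrite mul1r prod_normE/= normr0 ge_max lexx normr_ge0.
Defined.

Definition binr V W : bounded_op W (V * W)%type.
Proof.
refine (@mkbop _ _ (fun w => (0, w)) (@linear_pair2 V W) 1 _).
by move=> x; rewrite mul1r prod_normE/= normr0 ge_max lexx normr_ge0.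
Defined.

Definition bfst V W : bounded_op (V * W)%type V.
Proof.
refine (@mkbop _ _ fst _ 1 _); first by move=> a [x1 x2] [y1 y2].
by move=> x; rewrite mul1r prod_normE/= le_max lexx.
Defined.

Definition bsnd V W : bounded_op (V * W)%type W.
Proof.
refine (@mkbop _ _ snd _ 1 _); first by move=> a [x1 x2] [y1 y2].
by move=> x; rewrite mul1r prod_normE/= le_max lexx orbT.
Defined.

Lemma fderiv_near V W (f : V -> W) x : differentiable f x ->
  forall e : R, 0 < e ->
    \forall y \near x, `|f y - f x - fderiv f x (y - x)| <= e * `|y - x|.
Proof.
move=> df e e0.
have /eqaddoP/(_ _ e0) := diff_locally df.
rewrite nbhs0P/=; apply: filterS => y /=.
by rewrite !fctE/= opprD addrA [y + x]addrC [x + y - x]addrC addKr fderivE.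
Qed.

(** Uniqueness of the first-order expansion gives differentiability and the value of the derivative
    at once from an epsilon estimate. *)
Lemma fderivP V W (f : V -> W) x (A : bounded_op V W) :
  (forall e : R, 0 < e ->
    \forall y \near x, `|f y - f x - A (y - x)| <= e * `|y - x|) ->
  differentiable f x /\ fderiv f x = A.
Proof.
move=> fA.
have fo : f \o shift x = cst (f x) + (A : {linear V -> W}) +o_ 0 id.
  apply/eqaddoP => e e0.
  have := fA _ e0; rewrite nbhs0P/=; apply: filterS => y /=.
  by rewrite !fctE/= opprD addrA [y + x]addrC [x + y - x]addrC addKr.
have dA := diff_unique (@bounded_op_continuous _ _ _ A) fo.
have df : differentiable f x.
  apply/diff_locallyP; rewrite dA; split => //; exact: bounded_op_continuous.
by split => //; apply: bopP => h; rewrite fderivE// dA.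
Qed.

End FrechetCalculus.

(** * Calculus rules and closure properties of [Ck] maps *)

Section Smoothness.
Context {R : realType}.
Implicit Types U V W X : normedModType R.

Lemma fderiv_cst V W (a : W) (x : V) : fderiv (cst a) x = 0.
Proof. by apply: bopP => h; rewrite fderivE ?diff_cst. Qed.

Lemma differentiable_bop V W (A : bounded_op V W) x : differentiable A x.
Proof. by apply: linear_differentiable; exact: bounded_op_continuous. Qed.

Lemma fderiv_bop V W (A : bounded_op V W) x : fderiv A x = A.
Proof.
apply: bopP => h; rewrite fderivE; last exact: differentiable_bop.
by rewrite diff_lin//; exact: bounded_op_continuous.
Qed.

Lemma fderivD V W (f g : V -> W) x : differentiable f x -> differentiable g x ->
  fderiv (fun y => f y + g y) x = fderiv f x + fderiv g x.
Proof.
move=> df dg; have -> : (fun y => f y + g y) = f + g by apply/funext.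
have E := fderivE (differentiableD df dg); apply: bopP => h.
by rewrite E (diffD df dg) -(fderivE df) -(fderivE dg).
Qed.

Lemma fderivN V W (f : V -> W) x : differentiable f x ->
  fderiv (fun y => - f y) x = - fderiv f x.
Proof.
move=> df; have -> : (fun y => - f y) = - f by apply/funext.
have E := fderivE (differentiableN df); apply: bopP => h.
by rewrite E (diffN df) -(fderivE df).
Qed.

Lemma fderiv_comp V W X (f : V -> W) (g : W -> X) x :
  differentiable f x -> differentiable g (f x) ->
  fderiv (fun y => g (f y)) x = bcomp (fderiv g (f x)) (fderiv f x).
Proof.
move=> df dg; apply: bopP => h; rewrite bcompE.
rewrite (fderivE df) (fderivE dg) (fderivE (differentiable_comp df dg)).
by rewrite diff_comp.
Qed.

Lemma differentiable_fun_pair V W X (f : V -> W) (g : V -> X) x :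
  differentiable f x -> differentiable g x ->
  differentiable (fun y => (f y, g y)) x.
Proof. by move=> df dg; exact: differentiable_pair. Qed.

Lemma fderiv_pair V W X (f : V -> W) (g : V -> X) x h :
  differentiable f x -> differentiable g x ->
  fderiv (fun y => (f y, g y)) x h = (fderiv f x h, fderiv g x h).
Proof.
move=> df dg; rewrite !fderivE//; last exact: differentiable_fun_pair.
by rewrite diff_pair.
Qed.

Lemma bilinDl V W X (B : bounded_op V (bounded_op W X)) v1 v2 w :
  B (v1 + v2) w = B v1 w + B v2 w.
Proof. by rewrite linearD. Qed.

(** The remainder is exactly [B (q - p).1 (q - p).2], which is quadratic in [q - p]; the radius
    [e / (]|B| + 1)[makes it at most]e * [|q - p|]. *)
Lemma fderiv_bilin_near V W X (B : bounded_op V (bounded_op W X)) (p : V * W) :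
  forall e : R, 0 < e -> \forall q \near p,
    `|B q.1 q.2 - B p.1 p.2 - (B (q - p).1 p.2 + B p.1 (q - p).2)|
      <= e * `|q - p|.
Proof.
move=> e e0; have M0 : 0 < `|B| + 1 by rewrite ltr_wpDl.
apply/nbhs_normP; exists (e / (`|B| + 1)); first by rewrite /= divr_gt0.
move=> q /=; rewrite distrC => /ltW pq.
have -> : B q.1 q.2 - B p.1 p.2 - (B (q - p).1 p.2 + B p.1 (q - p).2) =
    B (q - p).1 (q - p).2.
  rewrite -{1 2}(subrK p q); move: (q - p) => r.
  rewrite /= !bilinDl !linearD /=.
  by rewrite !addrA !addrK addrAC addrK addrK.
have r1 : `|(q - p).1| <= `|q - p| by rewrite prod_normE le_max lexx.
have r2 : `|(q - p).2| <= `|q - p| by rewrite prod_normE le_max lexx orbT.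
apply: (le_trans (bop_norm (B (q - p).1) (q - p).2)); rewrite ler_pM//.
apply: (le_trans (bop_norm B (q - p).1)).
apply: (@le_trans _ _ ((`|B| + 1) * `|q - p|)); first by rewrite ler_pM// lerDl.
by rewrite mulrC -ler_pdivlMr.
Qed.

Lemma differentiable_bilin_op V W X (B : bounded_op V (bounded_op W X)) p :
  differentiable (fun q : V * W => B q.1 q.2) p /\
  forall h, fderiv (fun q : V * W => B q.1 q.2) p h = B h.1 p.2 + B p.1 h.2.
Proof.
pose A := bcomp (bflip B p.2) (bfst V W) + bcomp (B p.1) (bsnd V W).
have [] := @fderivP _ _ _ (fun q : V * W => B q.1 q.2) p A.
  exact: fderiv_bilin_near.
by move=> dB ->.
Qed.

Section bilin.
Variables (U V W X : normedModType R) (B : bounded_op V (bounded_op W X)).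
Variables (f : U -> V) (g : U -> W) (x : U).
Hypotheses (df : differentiable f x) (dg : differentiable g x).

Lemma differentiable_bilin2 : differentiable (fun y => B (f y) (g y)) x.
Proof.
apply: (@differentiable_comp _ _ _ _ (fun y => (f y, g y))
  (fun q : V * W => B q.1 q.2)); first exact: differentiable_fun_pair.
by have [] := differentiable_bilin_op B (f x, g x).
Qed.

(** The product rule is an equality of operators, not of values at [h], so that it can be
    differentiated again. *)
Lemma fderiv_bilin2 :
  fderiv (fun y => B (f y) (g y)) x =
  bcompB U V X (bflip B (g x)) (fderiv f x) +
  bcompB U W X (B (f x)) (fderiv g x).
Proof.
apply: bopP => h.
rewrite (@fderiv_comp _ _ _ (fun y => (f y, g y)) (fun q : V * W => B q.1 q.2)).
- rewrite bcompE (differentiable_bilin_op B _).2 fderiv_pair//.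
- exact: differentiable_fun_pair.
- exact: (differentiable_bilin_op B _).1.
Qed.

End bilin.

Lemma CkW V W k (f : V -> W) : Ck k.+1 f -> Ck k f.
Proof.
elim: k W f => [|k IH] W f [df cf].
  by move=> x; exact: differentiable_continuous.
by split => //; exact: IH.
Qed.

Lemma Ck_cst V W k (a : W) : Ck k (fun _ : V => a).
Proof.
elim: k W a => [|k IH] W a; first exact: cst_continuous.
split => [x|]; first exact: differentiable_cst.
rewrite (_ : fderiv _ = fun=> 0); first exact: IH.
by apply/funext => x; exact: fderiv_cst.
Qed.

Lemma Ck_bop V W k (A : bounded_op V W) : Ck k A.
Proof.
case: k => [|k]; first exact: bounded_op_continuous.
split => [x|]; first exact: differentiable_bop.
rewrite (_ : fderiv _ = fun=> A); first exact: Ck_cst.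
by apply/funext => x; exact: fderiv_bop.
Qed.

Lemma Ck_id V k : Ck k (fun x : V => x).
Proof.
(* The identity is factored through the product space to present it as a bounded operator. *)
rewrite (_ : (fun x => x) = fun x => bsnd V V (binr V V x)); last exact/funext.
by apply: (@Ck_bop _ _ _ (bcomp (bsnd V V) (binr V V))).
Qed.

Lemma CkD V W k (f g : V -> W) :
  Ck k f -> Ck k g -> Ck k (fun x => f x + g x).
Proof.
elim: k W f g => [|k IH] W f g.
  by move=> cf cg x; exact: (cvgD (cf x) (cg x)).
move=> [df cf] [dg cg]; split => [x|]; first exact: differentiableD.
have -> : fderiv (fun y => f y + g y) = (fun x => fderiv f x + fderiv g x).
  by apply/funext => x; exact: fderivD (df x) (dg x).
exact: IH cf cg.
Qed.

Lemma Ck_sum V W k I (r : seq I) (f : I -> V -> W) :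
  (forall i, Ck k (f i)) -> Ck k (fun x => \sum_(i <- r) f i x).
Proof.
move=> cf; elim: r => [|i r IH].
  rewrite (_ : (fun x => _) = fun=> 0); first exact: Ck_cst.
  by apply/funext => x; rewrite big_nil.
rewrite (_ : (fun x => _) = fun x => f i x + \sum_(j <- r) f j x).
  exact: CkD.
by apply/funext => x; rewrite big_cons.
Qed.

(** A bounded bilinear map is encoded curried, as a bounded operator into a
    space of bounded operators.  The derivative of [B (f x) (g x)] is then a sum
    of two terms of the same shape, hence the induction on [k]. *)
Lemma Ck_bilin U V W X k (B : bounded_op V (bounded_op W X))
    (f : U -> V) (g : U -> W) :
  Ck k f -> Ck k g -> Ck k (fun x => B (f x) (g x)).
Proof.
elim: k V W X B f g => [|k IH] V W X B f g.
  move=> cf cg x.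
  apply: (@continuous_comp _ _ _ (fun y => (f y, g y)) (fun q => B q.1 q.2)).
    exact: cvg_pair (cf x) (cg x).
  exact: differentiable_continuous (differentiable_bilin_op B _).1.
move=> cf cg; have [df cdf] := cf; have [dg cdg] := cg.
split => [x|]; first exact: differentiable_bilin2.
rewrite (_ : fderiv _ = fun x =>
  bcomp (bcompB U V X) (bflip B) (g x) (fderiv f x) +
  bcomp (bcompB U W X) B (f x) (fderiv g x)).
  by apply: CkD; apply: IH => //; exact: CkW.
by apply/funext => x; rewrite fderiv_bilin2.
Qed.

(** By the chain rule the derivative is [bcompB] applied to [fderiv g (f x)] and [fderiv f x], so
    [Ck_bilin] applies. The induction generalizes over [W] because [fderiv g] takes values in
    [bounded_op V W]. *)
Lemma Ck_comp U V W k (f : U -> V) (g : V -> W) :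
  Ck k f -> Ck k g -> Ck k (fun x => g (f x)).
Proof.
elim: k W g => [|k IH] W g.
  by move=> cf cg x; exact: continuous_comp (cf x) (cg _).
move=> cf [dg cg]; have [df cdf] := cf.
split => [x|]; first exact: differentiable_comp.
rewrite (_ : fderiv _ = fun x => bcompB U V W (fderiv g (f x)) (fderiv f x)).
  by apply: Ck_bilin => //; apply: IH => //; exact: CkW.
by apply/funext => x; rewrite fderiv_comp.
Qed.

Lemma differentiable_pairl V W X (F : V * W -> X) v w :
  differentiable F (v, w) -> differentiable (fun y => F (y, w)) v.
Proof.
move=> dF; apply: (@differentiable_comp _ _ _ _ (fun y => (y, w)) F) => //.
Qed.

Lemma differentiable_pairr V W X (F : V * W -> X) v w :
  differentiable F (v, w) -> differentiable (fun y => F (v, y)) w.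
Proof.
move=> dF; apply: (@differentiable_comp _ _ _ _ (fun y => (v, y)) F) => //.
Qed.

Lemma fderiv_pairl V W X (F : V * W -> X) v w : differentiable F (v, w) ->
  fderiv (fun y => F (y, w)) v = bcomp (fderiv F (v, w)) (binl V W).
Proof.
move=> dF; rewrite (@fderiv_comp _ _ _ (fun y => (y, w)) F)//.
apply: bopP => h; rewrite !bcompE fderiv_pair//.
by rewrite fderiv_cst; congr (fderiv F _ _); rewrite fderivE// diff_val.
Qed.

Lemma fderiv_pairr V W X (F : V * W -> X) v w : differentiable F (v, w) ->
  fderiv (fun y => F (v, y)) w = bcomp (fderiv F (v, w)) (binr V W).
Proof.
move=> dF; rewrite (@fderiv_comp _ _ _ (fun y => (v, y)) F)//.
apply: bopP => h; rewrite !bcompE fderiv_pair//.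
by rewrite fderiv_cst; congr (fderiv F _ _); rewrite fderivE// diff_val.
Qed.

End Smoothness.

(** * Matrices and networks *)

Section MatrixOperators.
Context {R : realType}.

Lemma mx_coord_norm m n (A : 'M[R]_(m, n)) i j : `|A i j| <= `|A|.
Proof.
rewrite [leRHS]mx_normrE.
exact: (@le_bigmax _ _ _ 0 (fun ij => `|A ij.1 ij.2|) (i, j)).
Qed.

Lemma mx_norm_le m n (A : 'M[R]_(m, n)) (M : R) : 0 <= M ->
  (forall i j, `|A i j| <= M) -> `|A| <= M.
Proof.
by move=> M0 AM; rewrite [leLHS]mx_normrE; apply/bigmax_leP; split.
Qed.

Definition bcoord m n (i : 'I_m) (j : 'I_n) : bounded_op 'M[R]_(m, n) R^o.
Proof.
refine (@mkbop R _ _ (fun A : 'M[R]_(m, n) => A i j : R^o) _ 1 _).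
- by move=> a x y; rewrite !mxE.
- by move=> x; rewrite mul1r; exact: mx_coord_norm.
Defined.

Definition bscale (V : normedModType R) (v : V) : bounded_op R^o V.
Proof.
refine (@mkbop R _ _ (fun r : R^o => (r : R) *: v) _ `|v| _).
- by move=> a x y; rewrite scalerDl scalerA.
- by move=> x; rewrite normrZ mulrC.
Defined.

(** The norm is the sup norm, and each entry of the product is a sum of [n] terms; hence the factor
    [n]. *)
Lemma mulmx_norm m n p (A : 'M[R]_(m, n)) (B : 'M[R]_(n, p)) :
  `|A *m B| <= (n%:R * `|A|) * `|B|.
Proof.
apply: mx_norm_le => [|i j]; first by rewrite !mulr_ge0.
rewrite mxE (le_trans (ler_norm_sum _ _ _))//.
apply: (@le_trans _ _ (\sum_(k < n) `|A| * `|B|)).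
  by apply: ler_sum => k _; rewrite normrM ler_pM// mx_coord_norm.
by rewrite sumr_const card_ord -mulrA mulr_natl.
Qed.

Definition bmulmxl m n p (A : 'M[R]_(m, n)) :
  bounded_op 'M[R]_(n, p) 'M[R]_(m, p).
Proof.
refine (@mkbop R _ _ (fun B : 'M[R]_(n, p) => A *m B) _ (n%:R * `|A|) _).
- by move=> a x y; rewrite linearP.
- exact: mulmx_norm.
Defined.

Definition bmulmx m n p :
  bounded_op 'M[R]_(m, n) (bounded_op 'M[R]_(n, p) 'M[R]_(m, p)).
Proof.
refine (@mkbop R _ _ (fun A : 'M[R]_(m, n) => bmulmxl p A) _ n%:R _).
- by move=> a x y; apply: bopP => B; rewrite /= mulmxDl -scalemxAl.
- by move=> A; apply: mkbop_norm; rewrite mulr_ge0.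
Defined.

Definition bmxdotl m n (A : 'M[R]_(m, n)) : bounded_op 'M[R]_(m, n) R^o.
Proof.
refine (@mkbop R _ _ (fun B : 'M[R]_(m, n) => mxdot A B : R^o) _
  ((m * n)%:R * `|A|) _).
- by move=> a x y; rewrite /mxdot mulmxDr -scalemxAr linearP.
- move=> B; rewrite mxdotE (le_trans (ler_norm_sum _ _ _))//.
  apply: (@le_trans _ _ (\sum_(i < m) \sum_(j < n) `|A| * `|B|)).
    apply: ler_sum => i _; rewrite (le_trans (ler_norm_sum _ _ _))//.
    by apply: ler_sum => j _; rewrite normrM ler_pM// mx_coord_norm.
  by rewrite !sumr_const !card_ord -mulrnA -mulrA mulr_natl mulnC.
Defined.

Definition bmxdot m n : bounded_op 'M[R]_(m, n) (dual R 'M[R]_(m, n)).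
Proof.
refine (@mkbop R _ _ (@bmxdotl m n) _ (m * n)%:R _).
- move=> a x y; apply: bopP => B.
  by rewrite /= /mxdot linearP mulmxDl -scalemxAl linearP.
- by move=> A; apply: mkbop_norm; rewrite mulr_ge0.
Defined.

(** The bound 1 comes from the elementary matrices, whose sup norm is at most 1. This operator turns
    equations in the dual into equations between matrices. *)
Definition briesz m n : bounded_op (dual R 'M[R]_(m, n)) 'M[R]_(m, n).
Proof.
refine (@mkbop R _ _ (fun f : dual R 'M[R]_(m, n) => mx_riesz f) _ 1 _).
- by move=> a x y; apply/matrixP => i j; rewrite !mxE.
- move=> f; rewrite mul1r; apply: mx_norm_le => // i j; rewrite mxE.
  rewrite (le_trans (bop_norm _ _))// ler_piMr//.
  apply: mx_norm_le => // i' j'; rewrite mxE.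
  by case: (_ && _); rewrite ?normr1 ?normr0.
Defined.

Lemma mxdotC m n (A B : 'M[R]_(m, n)) : mxdot A B = mxdot B A.
Proof.
by rewrite !mxdotE; apply: eq_bigr => i _; apply: eq_bigr => j _; rewrite mulrC.
Qed.

Lemma mxdotNl m n (A B : 'M[R]_(m, n)) : mxdot (- A) B = - mxdot A B.
Proof.
rewrite !mxdotE -sumrN; apply: eq_bigr => i _; rewrite -sumrN.
by apply: eq_bigr => j _; rewrite mxE mulNr.
Qed.

Lemma affdotC m n (a b : Aff R m n) : affdot a b = affdot b a.
Proof. by rewrite /affdot mxdotC [X in _ + X]mxdotC. Qed.

Lemma mxdot_eq0 m n (A : 'M[R]_(m, n)) : mxdot A A = 0 -> A = 0.
Proof.
rewrite mxdotE => /eqP; rewrite psumr_eq0 => [/allP A0|i _]; last first.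
  by apply: sumr_ge0 => j _; rewrite -expr2 sqr_ge0.
apply/matrixP => i j; rewrite mxE; apply/eqP.
have := A0 i (mem_index_enum _); rewrite /= psumr_eq0 => [/allP|k _];
  last by rewrite -expr2 sqr_ge0.
by move=> /(_ j (mem_index_enum _)); rewrite /= mulf_eq0 orbb.
Qed.

Lemma affdot_eq0 m n (a : Aff R m n) : affdot a a = 0 -> a = 0.
Proof.
have pos p q (A : 'M[R]_(p, q)) : 0 <= mxdot A A.
  rewrite mxdotE; apply: sumr_ge0 => i _; apply: sumr_ge0 => j _.
  by rewrite -expr2 sqr_ge0.
rewrite /affdot => /eqP; rewrite paddr_eq0//.
move=> /andP[/eqP/mxdot_eq0 a1 /eqP/mxdot_eq0 a2].
by rewrite [a]surjective_pairing a1 a2.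
Qed.

(** Here [bflip (bcompB _ _ _) (bfst _ _)] is precomposition with the first projection, and likewise
    for the second; this makes [affdot] a curried bilinear map. *)
Definition baffdot m n : bounded_op (Aff R m n) (dual R (Aff R m n)) :=
  bcomp (bflip (bcompB _ _ _) (bfst _ _)) (bcomp (bmxdot _ _) (bfst _ _)) +
  bcomp (bflip (bcompB _ _ _) (bsnd _ _)) (bcomp (bmxdot _ _) (bsnd _ _)).

Lemma baffdotE m n (a b : Aff R m n) : baffdot m n a b = affdot a b.
Proof. by []. Qed.

End MatrixOperators.

(** * Smoothness of networks in their input and weights *)

Section NetworkSmoothness.
Context {R : realType}.

(** Expanding along the canonical basis reduces the coordinatewise activation to compositions with
    bounded operators. *)
Lemma Ck_map_mx (rho : R -> R) k p (V : normedModType R) (f : V -> 'cV[R]_p) :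
  Ck k (rho : R^o -> R^o) -> Ck k f -> Ck k (fun x => map_mx rho (f x)).
Proof.
move=> crho cf.
rewrite (_ : (fun x => _) = fun x => \sum_(i < p)
   bscale (delta_mx i 0 : 'cV[R]_p) (rho (bcoord i 0 (f x)))).
  apply: Ck_sum => i.
  apply: (@Ck_comp _ _ _ _ _ (fun x => rho (bcoord i 0 (f x)) : R^o));
    last exact: Ck_bop.
  apply: (@Ck_comp _ _ _ _ _ (fun x => bcoord i 0 (f x) : R^o)) => //.
  by apply: Ck_comp => //; exact: Ck_bop.
apply/funext => x; rewrite [LHS]matrix_sum_delta.
by apply: eq_bigr => i _; rewrite big_ord1 mxE.
Qed.

Lemma Ck_aff_app k p q (V : normedModType R) (a : V -> Aff R p q)
    (z : V -> 'cV[R]_p) :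
  Ck k a -> Ck k z -> Ck k (fun x => aff_app (a x) (z x)).
Proof.
move=> ca cz.
rewrite (_ : (fun x => _) = fun x =>
  bmulmx _ _ _ (bfst _ _ (a x)) (z x) + bsnd _ _ (a x))//.
apply: CkD; last by apply: Ck_comp ca _; exact: Ck_bop.
by apply: Ck_bilin => //; apply: Ck_comp ca _; exact: Ck_bop.
Qed.

(** Weights and input both depend on the parameter [x], which yields joint regularity in the input
    and one layer. *)
Lemma Ck_layer k L n (V : normedModType R) (rho : R -> R)
    (w : V -> weights R L n) (u : V -> 'cV[R]_(n 0%N)) :
  Ck k (rho : R^o -> R^o) -> (forall l, Ck k (fun x => w x l)) -> Ck k u ->
  forall j (jL : (j <= L)%N), Ck k (fun x => layer rho (w x) (u x) jL).
Proof.
move=> crho cw cu; elim => [|j IH] jL //=.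
apply: Ck_aff_app; first exact: (cw (Ordinal jL)).
case: (j == 0%N); first exact: IH.
by apply: Ck_map_mx => //; exact: IH.
Qed.

Lemma Ck_dfwith k L n (w : weights R L n) (l i : 'I_L) :
  Ck k (fun a : Aff R (n l) (n l.+1) => dfwith w l a i).
Proof.
have [<-|li] := eqVneq l i.
  rewrite (_ : (fun a => _) = fun a => a); first exact: Ck_id.
  by apply/funext => a; rewrite dfwithin.
rewrite (_ : (fun a => _) = fun=> w i); first exact: Ck_cst.
by apply/funext => a; rewrite dfwithout.
Qed.

End NetworkSmoothness.

(** * Implicit functions *)

Section MeanValue.
Context {R : realType}.

Lemma fderiv_is_derive (f : R -> R) (x : R) :
  differentiable (f : R^o -> R^o) x ->
  is_derive x 1 f (fderiv (f : R^o -> R^o) x 1).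
Proof.
move=> df; have -> : fderiv (f : R^o -> R^o) x 1 = 'D_1 f x.
  by rewrite deriveE// fderivE.
by apply: derivableP; exact: diff_derivable.
Qed.

(** The scalar mean value theorem is applied to each entry along the segment from [x] to [y]. The
    intermediate point may vary with the entry, which is harmless for the sup norm. *)
Lemma mean_value_mx (V : normedModType R) m n (f : V -> 'M[R]_(m, n)) (x y : V)
    (C : R) :
  0 <= C -> (forall z, differentiable f z) ->
  (forall t : R, 0 <= t <= 1 ->
    `|fderiv f (x + t *: (y - x)) (y - x)| <= C * `|y - x|) ->
  `|f y - f x| <= C * `|y - x|.
Proof.
move=> C0 df fC; apply: mx_norm_le => [|i j]; first by rewrite mulr_ge0.
pose line (t : R^o) : V := x + bscale (y - x) t.
have dline t : differentiable line t.
  by apply: differentiableD;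
    [exact: differentiable_cst|exact: differentiable_bop].
have line_h t h : fderiv line t h = (h : R) *: (y - x).
  rewrite (fderivD (differentiable_cst _ _) (differentiable_bop _ _)).
  by rewrite fderiv_cst fderiv_bop add0r.
pose phi (t : R^o) : R^o := bcoord i j (f (line t)).
have dfl t : differentiable (fun t => f (line t)) t.
  exact: (differentiable_comp (dline t) (df (line t))).
have dphi t : differentiable phi t.
  exact: (differentiable_comp (dfl t) (differentiable_bop (bcoord i j) _)).
have phiE t : fderiv phi t 1 = fderiv f (x + (t : R) *: (y - x)) (y - x) i j.
  rewrite (fderiv_comp (dfl t) (differentiable_bop (bcoord i j) _)).
  rewrite fderiv_bop (fderiv_comp (dline t) (df _)) !bcompE line_h scale1r.
  by [].
have [||c c01] := @MVT_segment R phi (fun t => fderiv phi t 1) 0 1 ler01.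
- by move=> t _; exact: fderiv_is_derive.
- apply: continuous_subspaceT => t.
  exact: (differentiable_continuous (dphi t)).
rewrite subr0 mulr1 phiE /phi /line /= scale1r scale0r addr0 subrKC => E.
rewrite !mxE E; apply: (le_trans (mx_coord_norm _ _ _)); apply: fC.
by move: c01; rewrite in_itv.
Qed.

End MeanValue.

(** Completeness of column vectors is what the fixed point argument of [implicit_solve] rests on. *)
HB.instance Definition _ (R : realType) (m n : nat) :=
  Uniform_isComplete.Build 'M[R]_(m, n) cauchy_cvg.

(** * An implicit function theorem, normalized so that the partial derivative at the base point is
    the identity *)

Section ImplicitFunction.
Context {R : realType} (m : nat) (P : normedModType R).
Notation V := 'cV[R]_m.
Variables (F : V * P -> V) (x0 : V) (p0 : P).
Hypotheses (F1 : Ck 1 F) (F0 : F (x0, p0) = 0).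
Hypothesis (F'id : forall v, fderiv F (x0, p0) (v, 0) = v).

(** At the base point [u - F (u, p)] has zero derivative in [u]; continuity of [fderiv F] keeps this
    derivative below [e] nearby, and the mean value inequality concludes. *)
Lemma implicit_strict (e : R) : 0 < e -> exists2 d : R, 0 < d &
  forall u1 u2 p, `|u1 - x0| <= d -> `|u2 - x0| <= d -> `|p - p0| <= d ->
    `|(u1 - F (u1, p)) - (u2 - F (u2, p))| <= e * `|u1 - u2|.
Proof.
move=> e0; have [dF cF'] := F1.
have /cvgrPdist_le/(_ e e0)/nbhs_normP[d /= d0 Hd] := cF' (x0, p0).
(* Halving passes from the open ball of [Hd] to closed balls. *)
exists (d / 2); first by rewrite divr_gt0.
move=> u1 u2 p u1d u2d pd.
have dN u : differentiable (fun u => - F (u, p)) u.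
  exact: differentiableN (differentiable_pairl (dF _)).
have dG u : differentiable (fun u => u - F (u, p)) u.
  exact: differentiableD.
apply: (mean_value_mx (f := fun u => u - F (u, p)) (ltW e0) dG).
move=> t /andP[t0 t1].
set z := u2 + _; set v := u1 - u2.
(* Balls are convex, so the segment from [u2] to [u1] stays in this one. *)
have zd : `|z - x0| <= d / 2.
  have -> : z - x0 = (1 - t) *: (u2 - x0) + t *: (u1 - x0).
    by apply/matrixP => i j; rewrite /z !mxE; ring.
  rewrite (le_trans (ler_normD _ _))// !normrZ.
  rewrite ger0_norm ?subr_ge0// (ger0_norm t0).
  have -> : d / 2 = (1 - t) * (d / 2) + t * (d / 2) by ring.
  by rewrite lerD// ler_wpM2l// subr_ge0.
(* By [F'id], the vector [v] is [fderiv F (x0, p0) (v, 0)], so only a difference of two derivatives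
   of [F] remains. *)
have -> : fderiv (fun u => u - F (u, p)) z v =
    (fderiv F (x0, p0) - fderiv F (z, p)) (v, 0).
  rewrite (fderivD (ex_diff (is_diff_def := is_diff_id z)) (dN z)).
  rewrite (fderivN (differentiable_pairl (dF (z, p)))) fderiv_pairl//.
  rewrite !bounded_opDE F'id; congr (_ + _).
  by rewrite fderivE// diff_val.
apply: (le_trans (bop_norm _ _)); rewrite prod_normE /= normr0.
rewrite (@max_l _ _ `|v| 0)// ler_wpM2r//; apply: Hd => /=.
rewrite distrC prod_normE/= gt_max.
have dd : d / 2 < d by rewrite gtr_pMr// invf_lt1// ltr1n.
by rewrite (le_lt_trans zd dd) (le_lt_trans pd dd).
Qed.

(** Zeros of [F (_, p)] are the fixed points of [u - F (u, p)]. This map is a contraction of ratio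
    one half and moves [x0] by at most [d / 2], so it preserves the closed ball of radius [d]. *)
Lemma implicit_solve (d : R) (p : P) : 0 < d ->
  (forall u1 u2, `|u1 - x0| <= d -> `|u2 - x0| <= d ->
    `|(u1 - F (u1, p)) - (u2 - F (u2, p))| <= 2^-1 * `|u1 - u2|) ->
  `|F (x0, p)| <= d / 2 ->
  exists2 u, `|u - x0| <= d & F (u, p) = 0.
Proof.
move=> d0 H Fd; pose U : set V := [set u | `|u - x0| <= d].
pose f u := u - F (u, p).
have Ux0 : U x0 by rewrite /U /= subrr normr0 ltW.
have fU : {homo f : u / U u >-> U u}.
  move=> u Uu; rewrite /U /= /f.
  have -> : u - F (u, p) - x0 = (u - F (u, p) - (x0 - F (x0, p))) - F (x0, p).
    by rewrite opprB addrA [RHS]addrAC; congr (_ - _); rewrite addrK.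
  rewrite (le_trans (ler_normB _ _))// [leRHS]splitr lerD//.
  apply: (le_trans (H _ _ Uu Ux0)).
  by rewrite mulrC ler_wpM2r// invr_ge0.
have cU : closed U.
  have -> : U = closed_ball x0 d.
    rewrite closed_ballE//; apply/seteqP.
    by split => u; rewrite /U/closed_ball_/= distrC.
  exact: closed_ball_closed.
have [] := @banach_fixed_point R V U (mkfun_fun fU) _ cU (ex_intro _ x0 Ux0).
  have h0 : (0 : R) <= 2^-1 by rewrite invr_ge0.
  exists (NngNum h0); split => /=; first by rewrite invf_lt1// ltr1n.
  by move=> [u1 u2] [Uu1 Uu2]; exact: H.
move=> u Uu fu; exists u => //.
have : u = u - F (u, p) by [].
by move/eqP; rewrite -subr_eq0 opprB addrC subrK => /eqP.
Qed.

(** The comparison of [g p] with [x0] in [implicit_strict] shows that [g p - x0] equals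
    [- F (x0, p)] up to a small multiple of [g p - x0]; expanding [F (x0, p)] at [p0] gives the
    derivative. *)
Lemma implicit_function : exists g : P -> V,
  [/\ g p0 = x0, \forall p \near p0, F (g p, p) = 0, differentiable g p0 &
      forall h, fderiv g p0 h = - fderiv F (x0, p0) (0, h)].
Proof.
have [dF _] := F1.
have h0 : (0 : R) < 2^-1 by rewrite invr_gt0.
have [d d0 Hd] := implicit_strict h0.
(* [xget] picks some zero in the ball and falls back on [x0] if there is none; near [p0] a zero
   exists by [implicit_solve]. *)
pose g p := xget x0 [set u | `|u - x0| <= d /\ F (u, p) = 0].
pose D := bcomp (fderiv F (x0, p0)) (binr V P).
have dFp : differentiable (fun p => F (x0, p)) p0.
  exact: differentiable_pairr.
have DE : fderiv (fun p => F (x0, p)) p0 = D by exact: fderiv_pairr.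
have near_d (r : R) : 0 < r -> \forall p \near p0, `|p - p0| <= r.
  move=> r0; apply/nbhs_normP; exists r => //= p /=.
  by rewrite distrC => /ltW.
have gP : \forall p \near p0, `|g p - x0| <= d /\ F (g p, p) = 0.
  have cF := differentiable_continuous dFp.
  have /cvgrPdist_le/(_ (d / 2)) := cF; rewrite divr_gt0// => /(_ isT) Fd.
  near=> p.
  have pd : `|p - p0| <= d by near: p; exact: near_d.
  have Fpd : `|F (x0, p)| <= d / 2.
    rewrite -normrN -sub0r -F0; near: p; exact: Fd.
  have [u ud Fu] :=
    implicit_solve d0 (fun u1 u2 h1 h2 => Hd u1 u2 p h1 h2 pd) Fpd.
  by apply: (@xgetPex _ x0 [set u | `|u - x0| <= d /\ F (u, p) = 0]); exists u.
(* Since [F (g p, p) = 0], the ratio one half allows [g p - x0] to be absorbed on the left. At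
   [p = p0] this bound forces [g p0 = x0]. *)
have gF : \forall p \near p0, `|g p - x0| <= 2 * `|F (x0, p)|.
  near=> p.
  have pd : `|p - p0| <= d by near: p; exact: near_d.
  have [gd gp0] : `|g p - x0| <= d /\ F (g p, p) = 0 by near: p.
  have := Hd (g p) x0 p gd; rewrite subrr normr0 (ltW d0) => /(_ isT pd).
  rewrite gp0 subr0 => H.
  have gE : g p - x0 = g p - (x0 - F (x0, p)) - F (x0, p).
    by apply/matrixP => i j; rewrite !mxE; ring.
  have := ler_normB (g p - (x0 - F (x0, p))) (F (x0, p)); rewrite -gE.
  by move: H; lra.
have g0 : g p0 = x0.
  have := nbhs_singleton gF; rewrite F0 normr0 mulr0 normr_le0 subr_eq0.
  by move/eqP.
have [] := @fderivP _ _ _ g p0 (- D).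
  move=> e e0; pose C := `|D| + 1; have C0 : 0 < C by rewrite ltr_wpDl.
  have e'0 : 0 < e / (4 * C) by rewrite divr_gt0 ?mulr_gt0.
  have [d' d'0 Hd'] := implicit_strict e'0.
  have FC := fderiv_near dFp ltr01.
  have Fe := fderiv_near dFp (divr_gt0 e0 (ltr0Sn R 1)).
  near=> p.
  have [gd gp0] : `|g p - x0| <= d /\ F (g p, p) = 0 by near: p.
  have F2 : `|F (x0, p) - D (p - p0)| <= e / 2 * `|p - p0|.
    rewrite -DE -[F _ as X in X - _]subr0 -F0; near: p; exact: Fe.
  have F3 : `|F (x0, p)| <= C * `|p - p0|.
    have F4 : `|F (x0, p) - D (p - p0)| <= 1 * `|p - p0|.
      rewrite -DE -[F _ as X in X - _]subr0 -F0; near: p; exact: FC.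
    rewrite -[F _](subrK (D (p - p0))) (le_trans (ler_normD _ _))//.
    by rewrite addrC mulrDl lerD// bop_norm.
  have g2 : `|g p - x0| <= 2 * C * `|p - p0|.
    apply: (@le_trans _ _ (2 * `|F (x0, p)|)); first by near: p.
    by rewrite -mulrA ler_wpM2l.
  have pd : `|p - p0| <= d' by near: p; exact: near_d.
  have gd' : `|g p - x0| <= d'.
    apply: (le_trans g2); rewrite -ler_pdivlMl ?mulr_gt0//.
    by near: p; apply: near_d; rewrite mulr_gt0// invr_gt0 mulr_gt0.
  have := Hd' (g p) x0 p gd'; rewrite subrr normr0 (ltW d'0) => /(_ isT pd).
  rewrite gp0 subr0 => H.
  rewrite g0.
  have -> : g p - x0 - (- D) (p - p0) =
     (g p - (x0 - F (x0, p))) - (F (x0, p) - D (p - p0)).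
    rewrite (_ : (- D) (p - p0) = - D (p - p0))//.
    by apply/matrixP => i j; rewrite !mxE; ring.
  rewrite (le_trans (ler_normB _ _))// [e]splitr mulrDl lerD//.
  apply: (le_trans H).
  apply: (@le_trans _ _ (e / (4 * C) * (2 * C * `|p - p0|))).
    by rewrite ler_wpM2l// ltW.
  rewrite mulrA ler_wpM2r//.
  rewrite (_ : e / (4 * C) * (2 * C) = e / 2)//.
  by field; rewrite gt_eqF.
move=> dg gE; exists g; split => //; first by apply: filterS gP => p [].
by move=> h; rewrite gE.
Unshelve. all: by end_near. Qed.

End ImplicitFunction.

(** * Optimality *)

Section FirstOrderCondition.
Context {R : realType}.
Implicit Types U V W : normedModType R.

(** A direction of negative derivative would make [f] decrease strictly along it; nonnegativity in
    the directions [h] and [- h] then forces the derivative to vanish. *)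
Lemma fderiv_local_min V (f : V -> R^o) x : differentiable f x ->
  (\forall y \near x, (f x : R) <= f y) -> fderiv f x = 0.
Proof.
move=> df fmin.
have pos h : (0 : R) <= fderiv f x h.
  rewrite leNgt; apply/negP => dneg; set d : R := fderiv f x h in dneg.
  have h1 : 0 < `|h| + 1 by rewrite ltr_wpDl.
  (* With this tolerance the remainder at [x + t *: h] is at most [t * (- d / 2)], half of the
     linear decrease; adding 1 covers [h = 0]. *)
  have e0 : 0 < - d / 2 / (`|h| + 1) by rewrite !divr_gt0// oppr_gt0.
  have : \forall y \near x, `|f y - f x - fderiv f x (y - x)|
      <= - d / 2 / (`|h| + 1) * `|y - x| /\ (f x : R) <= f y.
    by apply: filterI fmin; exact: fderiv_near.
  move/nbhs_normP => [r /= r0 Hr].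
  pose t := r / 2 / (`|h| + 1).
  have t0 : 0 < t by rewrite !divr_gt0.
  have th : `|x + t *: h - x| = t * `|h|.
    by rewrite addrAC subrr add0r normrZ gtr0_norm.
  have hh : `|h| / (`|h| + 1) <= 1 by rewrite ler_pdivrMr// mul1r lerDl.
  have [|] := Hr (x + t *: h).
    rewrite /= distrC th /t mulrAC -mulrA.
    apply: (@le_lt_trans _ _ (r / 2 * 1)).
      by rewrite ler_wpM2l// ltW// divr_gt0.
    by rewrite mulr1 gtr_pMr// invf_lt1// ltr1n.
  rewrite th [x + _ - x]addrAC subrr add0r linearZ /= => H1 H2.
  have {H1} := le_trans (ler_norm _) H1.
  have : - d / 2 / (`|h| + 1) * (t * `|h|) <= t * (- d / 2).
    rewrite mulrCA ler_wpM2l ?(ltW t0)// mulrAC -mulrA.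
    by rewrite -[leRHS]mulr1 ler_wpM2l// ltW// divr_gt0// oppr_gt0.
  have : t * d < 0 by rewrite pmulr_rlt0.
  move: H2; rewrite /GRing.scale /= -/d; lra.
apply: bopP => h; apply/eqP; rewrite eq_le; apply/andP; split; last exact: pos.
by rewrite -oppr_ge0 -linearN; exact: pos.
Qed.

Lemma bounded_op_sumE V W I (r : seq I)
    (f : I -> bounded_op V W) h :
  (\sum_(i <- r) f i) h = \sum_(i <- r) f i h.
Proof.
by elim: r => [|i r IH]; rewrite ?big_nil// !big_cons bounded_opDE IH.
Qed.

Lemma fderiv_quadratic U V (B : bounded_op V (dual R V)) (f : U -> V) (x : U) :
  (forall v v', B v v' = B v' v) -> differentiable f x ->
  forall h, fderiv (fun y => B (f y) (f y)) x h =
            2 * (B (f x) (fderiv f x h) : R) :> R.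
Proof.
move=> BC df h; rewrite fderiv_bilin2// bounded_opDE.
by rewrite mulr_natl mulr2n; congr (_ + _); exact: BC.
Qed.

Lemma fderiv_sum V W I (r : seq I) (f : I -> V -> W) x :
  (forall i, differentiable (f i) x) ->
  differentiable (fun y => \sum_(i <- r) f i y) x /\
  fderiv (fun y => \sum_(i <- r) f i y) x = \sum_(i <- r) fderiv (f i) x.
Proof.
move=> df; elim: r => [|i r [IHd IH]].
  rewrite (_ : (fun y => _) = cst 0);
    last by apply/funext => y; rewrite big_nil.
  by rewrite big_nil; split; [exact: differentiable_cst|exact: fderiv_cst].
rewrite (_ : (fun y => _) = fun y => f i y + \sum_(j <- r) f j y).
  split; first exact: differentiableD.
  by rewrite big_cons fderivD// IH.
by apply/funext => y; rewrite big_cons.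
Qed.

Lemma fderivZ V W (a : R) (f : V -> W) x : differentiable f x ->
  fderiv (fun y => a *: f y) x = a *: fderiv f x.
Proof.
move=> df; have -> : (fun y => a *: f y) = a *: f by apply/funext.
have E := fderivE (@differentiableZ _ _ _ f a x df); apply: bopP => h.
by rewrite E (diffZ _ df) -(fderivE df).
Qed.

End FirstOrderCondition.

(** * Implicit branches for equations with values in the dual *)

Section SolutionBranch.
Context {R : realType} (m : nat) (P : normedModType R).
Notation V := 'cV[R]_m.

Lemma mx_riesz_inj (f : dual R V) : mx_riesz f = 0 -> f = 0.
Proof.
move=> f0; apply: bopP => h; rewrite -(mx_rieszP f) f0 /mxdot.
by rewrite trmx0 mul0mx mxtrace0.
Qed.

(** In coordinates the adjoint is the transposed matrix, so its injectivity is invertibility of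
    [M]. *)
Lemma mx_adj_mul (A : bounded_op V (dual R V)) : exists M : 'M[R]_m,
  (forall v, mx_riesz (A v) = M *m v) /\ (forall mu, mx_adj A mu = M^T *m mu).
Proof.
pose M : 'M[R]_m := \matrix_(i, j) (A (delta_mx j 0) (delta_mx i 0)).
have E v : mx_riesz (A v) = M *m v.
  apply/matrixP => i j; rewrite !mxE ord1.
  rewrite [in LHS](matrix_sum_delta v) -[LHS]bflipE linear_sum.
  apply: eq_bigr => k _; rewrite big_ord1 linearZ /= mxE.
  by rewrite mulrC.
exists M; split => // mu; apply/matrixP => i j; rewrite ord1.
rewrite [LHS]mxE -(mx_rieszP (A _)) E mxdotC mxdotE [RHS]mxE.
apply: eq_bigr => k _; rewrite big_ord1 !mxE mulrC; congr (_ * _).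
rewrite (bigD1 i)//= big1 => [|k' k'i]; last first.
  by rewrite !mxE (negbTE k'i) mulr0.
by rewrite !mxE !eqxx mulr1 addr0.
Qed.

(** Adding a kernel element to [mu] gives another solution of the affine equation, which uniqueness
    excludes. *)
Lemma adjoint_injective (A : bounded_op V (dual R V)) (z mu : V) :
  unique (fun x => mx_adj A x + z = 0) mu ->
  forall x, mx_adj A x = 0 -> x = 0.
Proof.
move=> [muz mu1] x Ax; have [M [_ MT]] := mx_adj_mul A.
have := mu1 (mu + x); rewrite MT mulmxDr -!MT Ax addr0 => /(_ muz) /eqP.
by rewrite -subr_eq0 opprD addNKr oppr_eq0 => /eqP.
Qed.

(** Composing [G] with the injective operator [N] keeps its zeros and makes its partial derivative
    in [V] the identity, as [implicit_function] requires. *)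
Lemma solution_branch (G : V * P -> dual R V) (x0 : V) (p0 : P) :
  Ck 1 G -> G (x0, p0) = 0 ->
  (forall mu, mx_adj (bcomp (fderiv G (x0, p0)) (binl V P)) mu = 0 -> mu = 0) ->
  exists g : P -> V,
    [/\ g p0 = x0, \forall p \near p0, G (g p, p) = 0, differentiable g p0 &
      forall h, bcomp (fderiv G (x0, p0)) (binl V P) (fderiv g p0 h) =
        - bcomp (fderiv G (x0, p0)) (binr V P) h].
Proof.
move=> G1 G0; set A := bcomp _ _; set B := bcomp _ _ => Ainj.
have [M [MA MT]] := mx_adj_mul A.
have Mu : M \in unitmx.
  rewrite -row_free_unit; apply: inj_row_free => v vM.
  apply: trmx_inj; rewrite trmx0; apply: Ainj.
  by rewrite MT -trmx_mul vM trmx0.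
pose N := bcomp (bmulmxl 1 (invmx M)) (briesz m 1).
have NE f : N f = invmx M *m mx_riesz f by [].
have Ninj f : N f = 0 -> f = 0.
  rewrite NE => /(congr1 (mulmx M)).
  by rewrite mulKVmx// mulmx0 => /mx_riesz_inj.
have dG := G1.1.
have FE q : fderiv (fun q => N (G q)) q = bcomp N (fderiv G q).
  rewrite (fderiv_comp (dG q) (differentiable_bop N _)).
  by rewrite fderiv_bop.
have F1 : Ck 1 (fun q => N (G q)) by apply: Ck_comp G1 _; exact: Ck_bop.
have F0 : N (G (x0, p0)) = 0 by rewrite G0 linear0.
have [|g [g0 gF dg g']] := implicit_function F1 F0.
  move=> v; rewrite FE bcompE NE.
  by rewrite (_ : fderiv G (x0, p0) (v, 0) = A v)// MA mulKmx.
exists g; split => //; first by apply: filterS gF => p /Ninj.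
(* The identity is checked after applying [N], which inverts [A]. *)
move=> h; apply/eqP; rewrite -addr_eq0; apply/eqP/Ninj.
rewrite linearD /= [X in X + _]NE MA mulKmx// g' FE.
by rewrite bcompE addNr.
Qed.

End SolutionBranch.

(** * The inner gradient as a function of the input and a single layer *)

Section ReducedProblem.
Context {R : realType} {Y : normedModType R} {L : nat} {n : nat -> nat}.
Variables (c : Y -> Y -> R) (gamma : 'cV[R]_(n L) -> R) (rho : R -> R).
Variable Smap : 'cV[R]_(n 0%N) -> Y.
Variables (w : weights R L n) (l : 'I_L).
Notation V := 'cV[R]_(n 0%N).
Notation P := (Aff R (n l) (n l.+1)).

Lemma dfwith_self : dfwith w l (w l) = w.
Proof.
apply: functional_extensionality_dep => i.
have [<-|li] := eqVneq l i; first by rewrite dfwithin.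
by rewrite dfwithout.
Qed.

Lemma weights_sqnorm_dfwith (a : P) :
  weights_sqnorm (dfwith w l a) =
  affdot a a + \sum_(i < L | i != l) affdot (w i) (w i).
Proof.
rewrite /weights_sqnorm (bigD1 l)//= dfwithin; congr (_ + _).
by apply: eq_bigr => i il; rewrite dfwithout// eq_sym.
Qed.

Variable y : Y.
Hypotheses (hgamma : Ck 2 (gamma : _ -> R^o)) (hrho : Ck 2 (rho : R^o -> R^o)).
Hypotheses (hS : Ck 2 Smap) (hc : Ck 2 ((fun z => c z y) : Y -> R^o)).

Let state_cost (v : V) : R^o := c (Smap v) y.
Let regularizer (q : V * P) : R^o := gamma (network rho (dfwith w l q.2) q.1).

Lemma Ck_state_cost : Ck 2 state_cost.
Proof. exact: (Ck_comp hS hc). Qed.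

Lemma Ck_regularizer : Ck 2 regularizer.
Proof.
apply: (@Ck_comp _ _ _ _ _ (fun q : V * P => network rho (dfwith w l q.2) q.1)).
  apply: Ck_layer => // [i|]; last exact: (Ck_bop _ (bfst V P)).
  apply: (@Ck_comp _ _ _ _ _ (bsnd V P) (fun a : P => dfwith w l a i)).
    exact: Ck_bop.
  exact: Ck_dfwith.
exact: hgamma.
Qed.

Definition joint_grad (q : V * P) : dual R V :=
  inner_grad c gamma rho Smap q.1 (dfwith w l q.2) y.

(** The gradient in the input is the full derivative of [regularizer] precomposed with [binl], plus
    that of [state_cost]; one order of differentiability is lost. *)
Lemma Ck_joint_grad : Ck 1 joint_grad.
Proof.
have [ds cs] := Ck_state_cost; have [dr cr] := Ck_regularizer.
rewrite (_ : joint_grad = fun q => fderiv state_cost (bfst V P q) +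
  bflip (bcompB V (V * P)%type R^o) (binl V P) (fderiv regularizer q)).
  apply: CkD.
    apply: (@Ck_comp _ _ _ _ _ (bfst V P) (fderiv state_cost)); last exact: cs.
    exact: Ck_bop.
  apply: (@Ck_comp _ _ _ _ _ (fderiv regularizer)
    (bflip (bcompB V (V * P)%type R^o) (binl V P))); first exact: cr.
  exact: Ck_bop.
apply/funext => -[v a]; rewrite /joint_grad /inner_grad /=.
have dra := differentiable_pairl (dr (v, a)).
by rewrite (fderivD (ds v) dra) (fderiv_pairl (dr (v, a))).
Qed.

Lemma inner_grad_uE v :
  inner_grad_u c gamma rho Smap v w y =
  bcomp (fderiv joint_grad (v, w l)) (binl V P).
Proof.
rewrite -(fderiv_pairl (Ck_joint_grad.1 (v, w l))) /inner_grad_u.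
by rewrite /joint_grad /= dfwith_self.
Qed.

Lemma inner_grad_wE v :
  inner_grad_w c gamma rho Smap l v w y =
  bcomp (fderiv joint_grad (v, w l)) (binr V P).
Proof. by rewrite -(fderiv_pairr (Ck_joint_grad.1 (v, w l))). Qed.

End ReducedProblem.

Theorem theorem4p4 (R : realType) (Y Q : completeNormedModType R)
    (L K : nat) (n : nat -> nat)
    (phi : Y * 'cV[R]_(n 0%N) -> dual R Q)
    (c : Y -> Y -> R) (gamma : 'cV[R]_(n L) -> R) (rho : R -> R)
    (Smap : 'cV[R]_(n 0%N) -> Y)
    (Yhat : set Y) (yhat : 'I_K -> Y) (uhat : 'I_K -> 'cV[R]_(n 0%N))
    (nu : R) (u : 'I_K -> 'cV[R]_(n 0%N)) (w : weights R L n)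
    (hQ : reflexive_space Q)
    (hL : (0 < L)%N) (hK : (0 < K)%N)
    (hgamma : forall k, Ck k (gamma : _ -> R^o))
    (hYhat : finite_dim_subspace Yhat) (hyhat : forall k, Yhat (yhat k))
    (hphi_C2 : Ck 2 phi)
    (hphi_ex : forall v, exists y, phi (y, v) = 0)
    (hphi_surj : forall y v (q : dual R Q),
       exists h, fderiv (fun y' => phi (y', v)) y h = q)
    (hphi_bound : forall y v, exists2 C : R, 0 < C &
       forall h, `|h| <= C * `|fderiv (fun y' => phi (y', v)) y h|)
    (hc_min : forall k, exists y v, phi (y, v) = 0 /\
       forall y' v', phi (y', v') = 0 -> c y (yhat k) <= c y' (yhat k))
    (hc_C2 : forall z, Yhat z -> Ck 2 ((fun y => c y z) : Y -> R^o))
    (hrho : Ck 2 (rho : R^o -> R^o))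
    (hS_C2 : Ck 2 Smap)
    (hS : forall y v, phi (y, v) = 0 <-> y = Smap v)
    (hnu : 0 <= nu)
    (hsol : outer_solution c gamma rho Smap yhat uhat nu u w) :
  (forall k, inner_grad c gamma rho Smap (u k) w (yhat k) = 0) /\
  (forall mu : 'I_K -> 'cV[R]_(n 0%N),
     (forall k, unique (adjoint_equation c gamma rho Smap yhat uhat u w k) (mu k)) ->
     forall l : 'I_L, outer_grad c gamma rho Smap yhat nu u w mu l = 0).
Proof.
have [feas opt] := hsol; split=> // mu hmu l.
pose P := Aff R (n l) (n l.+1).
have hcy k : Ck 2 ((fun z => c z (yhat k)) : Y -> R^o) by exact: hc_C2.
pose G k := @joint_grad R Y L n c gamma rho Smap w l (yhat k).
have G1 k : Ck 1 (G k) by exact: Ck_joint_grad.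
pose A k := bcomp (fderiv (G k) (u k, w l)) (binl 'cV[R]_(n 0%N) P).
pose B k := bcomp (fderiv (G k) (u k, w l)) (binr 'cV[R]_(n 0%N) P).
have AE k : inner_grad_u c gamma rho Smap (u k) w (yhat k) = A k.
  exact: inner_grad_uE.
have BE k : inner_grad_w c gamma rho Smap l (u k) w (yhat k) = B k.
  exact: inner_grad_wE.
have G0 k : G k (u k, w l) = 0 by rewrite /G /joint_grad /= dfwith_self feas.
(* Unique solvability of the adjoint equation is the source of the invertibility of the partial
   derivative in [u]. *)
have Ainj k x : mx_adj (A k) x = 0 -> x = 0.
  apply: (@adjoint_injective R _ (A k) (u k - uhat k) (mu k)).
  by rewrite -AE; exact: hmu.
have /choice[g gP] k := solution_branch (G1 k) (G0 k) (@Ainj k).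
pose dev k (a : P) := g k a - uhat k.
have ddev k : differentiable (dev k) (w l).
  by have [_ _ dg _] := gP k; apply: differentiableB.
have dev'E k : fderiv (dev k) (w l) = fderiv (g k) (w l).
  have [_ _ dg _] := gP k.
  by rewrite (fderivD dg (differentiable_cst _ _)) fderiv_cst addr0.
pose sq k (a : P) : R^o := bmxdot _ _ (dev k a) (dev k a).
have dsq k : differentiable (sq k) (w l) by exact: differentiable_bilin2.
have [dsum sumE] := fderiv_sum (index_enum 'I_K) dsq.
pose qw (a : P) : R^o := baffdot _ _ a a.
have did : differentiable (fun a : P => a) (w l) by [].
have dqw : differentiable qw (w l) by exact: (differentiable_bilin2 _ did did).
pose rest : R^o := \sum_(i < L | i != l) affdot (w i) (w i).
pose Phi (a : P) : R^o := (2 * K%:R)^-1 *: (\sum_(k < K) sq k a) +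
  (nu / 2) *: (qw a + rest).
have dqr : differentiable (fun a => qw a + rest) (w l).
  by apply: differentiableD.
have PhiE a : Phi a = outer_objective uhat nu (fun k => g k a) (dfwith w l a).
  by rewrite /outer_objective weights_sqnorm_dfwith.
have dZ1 : differentiable
    (fun a : P => (2 * K%:R)^-1 *: \sum_(k < K) sq k a : R^o) (w l).
  exact: differentiableZ.
have dZ2 : differentiable (fun a : P => (nu / 2) *: (qw a + rest)) (w l).
  exact: differentiableZ.
have dPhi : differentiable Phi (w l) by exact: differentiableD.
have Phimin : \forall a \near w l, (Phi (w l) : R) <= Phi a.
  (* There are finitely many data, so one neighborhood of [w l] makes all the branches feasible
     simultaneously. *)
  have Gnear : \forall a \near w l, forall k, G k (g k a, a) = 0.
    have gG k : \forall a \near w l, G k (g k a, a) = 0 by have [] := gP k.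
    exact: (filter_forall (nbhs_filter (w l)) gG).
  apply: filterS Gnear => a Ga; rewrite !PhiE dfwith_self.
  rewrite (_ : (fun k => g k (w l)) = u); first exact: opt.
  by apply/funext => k; have [] := gP k.
have Phi0 := fderiv_local_min dPhi Phimin.
(* The branch equation replaces [B k h] by [- A k (fderiv (g k) (w l) h)]; moving [A k] onto [mu k]
   and using the adjoint equation leaves the residual. *)
have Bmu k h : B k h (mu k) = mxdot (u k - uhat k) (fderiv (g k) (w l) h).
  have [_ _ _ /(_ h) gk] := gP k; have [adj _] := hmu k.
  move: adj; rewrite /adjoint_equation AE => /eqP.
  rewrite addrC addr_eq0 => /eqP ->.
  rewrite -[B k h]opprK -gk bcompE.
  by rewrite [RHS]mxdotNl mx_adjP.
(* This is [fderiv Phi (w l) h = 0]; the factor 2 from each square cancels the halves in the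
   objective. *)
have stat h :
    nu * affdot (w l) h + K%:R^-1 * \sum_(k < K) (B k h (mu k) : R) = 0.
  have := congr1 (fun T : bounded_op P R^o => T h : R) Phi0.
  rewrite (fderivD dZ1 dZ2).
  rewrite (fderivZ _ dsum) (fderivZ _ dqr).
  rewrite (fderivD dqw (differentiable_cst _ _)).
  rewrite fderiv_cst addr0 sumE bounded_opDE !bounded_opZE.
  have -> : fderiv qw (w l) h = 2 * affdot (w l) h :> R.
    rewrite (@fderiv_quadratic _ _ _ (baffdot _ _) _ _
      (@affdotC _ _ _) did).
    by rewrite (fderivE did) diff_val.
  have -> : (\sum_k fderiv (sq k) (w l)) h = \sum_k 2 * (B k h (mu k) : R) :> R.
    rewrite bounded_op_sumE; apply: eq_bigr => k _; rewrite Bmu -dev'E.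
    have [<- _ _ _] := gP k.
    exact: (@fderiv_quadratic _ _ _ (bmxdot _ _) _ _ (@mxdotC _ _ _) (ddev k)).
  rewrite -mulr_sumr /GRing.scale /= => E.
  rewrite -[RHS]E addrC; congr (_ + _).
    by rewrite invfM mulrACA mulVf ?pnatr_eq0// mul1r.
  by rewrite mulrA divfK.
set h := outer_grad _ _ _ _ _ _ _ _ _ _.
have hE : h = nu *: w l + K%:R^-1 *: \sum_(k < K) aff_adj (B k) (mu k).
  by congr (_ + _ *: _); apply: eq_bigr => k _; rewrite BE.
(* Stationarity is tested in the direction [h] of the outer gradient itself, so that its squared
   Euclidean norm vanishes. *)
apply: affdot_eq0; rewrite -[RHS](stat h) {1}hE -baffdotE -bflipE linearD.
rewrite !linearZ linear_sum /=; congr (_ + _ * _).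
by apply: eq_bigr => k _; exact: (aff_adjP (B k) (mu k) h).
Qed.
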